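(* Let $\lambda,\mu,\rho,\omega>0$, let $C_p=\sqrt{(\lambda+2\mu)/\rho}$ and $C_s=\sqrt{\mu/\rho}$, and for $k\ge 0$ and $\delta>0$ let $\rho_{cla}(k,\omega,C_p,C_s,\delta)$ be the convergence factor, in the Fourier mode $k$, of the classical overlapping Schwarz method with overlap $\delta$ applied to the time-harmonic Navier equations (its explicit formula is given in the context). Then: (i) for every $\delta>0$ and every $k\in[0,\frac{\omega}{C_p}]\cup\{\frac{\omega}{C_s}\}$, $|\rho_{cla}(k,\omega,C_p,C_s,\delta)|=1$; and for all sufficiently small overlap $\delta>0$ (i.e. there is $\delta_0>0$ depending only on $\omega,C_p,C_s$ such that for all $\delta\in(0,\delta_0)$): (ii) $|\rho_{cla}(k,\omega,C_p,C_s,\delta)|>1$ for all $k\in(\frac{\omega}{C_p},\frac{\omega}{C_s})$; (iii) $|\rho_{cla}(k,\omega,C_p,C_s,\delta)|<1$ for all $k\in(\frac{\omega}{C_s},\infty)$.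
   Context: The Navier equations in the frequency domain are $-(\Delta^e+\omega^2\rho)\mathbf{u}=\mathbf{f}$, with $\Delta^e\mathbf{u}=\mu\Delta\mathbf{u}+(\lambda+\mu)\nabla(\nabla\cdot\mathbf{u})$, posed on $\Omega=\mathbb{R}^2$. The domain is decomposed into $\Omega_1=(-\infty,\delta)\times\mathbb{R}$ and $\Omega_2=(0,\infty)\times\mathbb{R}$, with overlap $\delta>0$. The classical parallel Schwarz method computes, for $n=1,2,\dots$, from initial guesses $\mathbf{u}_1^0,\mathbf{u}_2^0$, solutions of $-(\Delta^e+\omega^2\rho)\mathbf{u}_j^n=\mathbf{f}$ in $\Omega_j$, $j=1,2$, with $\mathbf{u}_1^n=\mathbf{u}_2^{n-1}$ at $x=\delta$ and $\mathbf{u}_2^n=\mathbf{u}_1^{n-1}$ at $x=0$. Taking the Fourier transform in $y$ with Fourier variable $k$, its convergence factor in the mode $k$ is $$\rho_{cla}(k,\omega,C_p,C_s,\delta)=\max\{|r_+|,|r_-|\},$$ $$r_\pm=\frac{X^2}{2}+e^{-\delta(\lambda_1+\lambda_2)}\pm\frac12\sqrt{X^2\left(X^2+4e^{-\delta(\lambda_1+\lambda_2)}\right)},\qquad X=\frac{k^2+\lambda_1\lambda_2}{k^2-\lambda_1\lambda_2}\left(e^{-\lambda_1\delta}-e^{-\lambda_2\delta}\right),$$ where $\lambda_1=\sqrt{k^2-\omega^2/C_s^2}$ and $\lambda_2=\sqrt{k^2-\omega^2/C_p^2}$; when the radicand is negative the root is taken in $\mathrm{i}\mathbb{R}_+$,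 i.e. $\lambda_1=\mathrm{i}\sqrt{\omega^2/C_s^2-k^2}$ and $\lambda_2=\mathrm{i}\sqrt{\omega^2/C_p^2-k^2}$. (The complex square root in $r_\pm$ may be any branch, since only the pair $\{r_+,r_-\}$ matters.) *)

(* Defs.v *)
From Stdlib Require Import Reals Lra.
From Coquelicot Require Import Coquelicot.
Open Scope R_scope.

Definition Cexp (z : C) : C := (exp (Re z) * cos (Im z), exp (Re z) * sin (Im z)).

(* Square root of a real radicand, taken in i R_+ when it is negative. *)
Definition root (x : R) : C :=
  if Rle_dec 0 x then RtoC (sqrt x) else (Ci * RtoC (sqrt (- x)))%C.

(* Principal branch of the complex square root.  The choice of branch does not
   affect [rho_cla]: replacing [Csqrt] by its opposite swaps [r_plus] and [r_minus]. *)
Definition Csqrt (z : C) : C :=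
  (sqrt ((Cmod z + Re z) / 2),
   (if Rle_dec 0 (Im z) then 1 else -1) * sqrt ((Cmod z - Re z) / 2)).

Lemma Csqrt_sqr (z : C) : (Csqrt z * Csqrt z)%C = z.
Proof.
destruct z as [a b].
set (m := Cmod (a, b)).
assert (Hm : m * m = a * a + b * b).
{ unfold m, Cmod; simpl fst; simpl snd.
  rewrite sqrt_sqrt; [ring | nra]. }
assert (Hm0 : 0 <= m) by apply Cmod_ge_0.
assert (Hp : 0 <= (m + a) / 2) by nra.
assert (Hn : 0 <= (m - a) / 2) by nra.
assert (Hpn : sqrt ((m + a) / 2) * sqrt ((m - a) / 2) = Rabs b / 2).
{ rewrite <- sqrt_mult by assumption.
  replace ((m + a) / 2 * ((m - a) / 2)) with (Rsqr (Rabs b / 2)).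
  - apply sqrt_Rsqr. generalize (Rabs_pos b); lra.
  - unfold Rsqr. replace (Rabs b / 2 * (Rabs b / 2)) with (Rabs b * Rabs b / 4) by field.
    replace (Rabs b * Rabs b) with (b * b).
    + replace (b * b) with (m * m - a * a) by lra. field.
    + unfold Rabs; destruct (Rcase_abs b); ring. }
generalize (sqrt_sqrt _ Hp) (sqrt_sqrt _ Hn); intros Sp Sn.
unfold Csqrt, Cmult; fold m; simpl Re; simpl Im; simpl fst; simpl snd.
set (p := sqrt ((m + a) / 2)) in *; set (q := sqrt ((m - a) / 2)) in *.
unfold Rabs in Hpn; destruct (Rcase_abs b); destruct (Rle_dec 0 b);
  try (exfalso; lra); f_equal; nra.
Qed.

Section ConvergenceFactor.

Variables k omega Cp Cs delta : R.

Definition lambda1 : C := root (k ^ 2 - omega ^ 2 / Cs ^ 2).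
Definition lambda2 : C := root (k ^ 2 - omega ^ 2 / Cp ^ 2).

Definition Xcla : C :=
  ((RtoC (k ^ 2) + lambda1 * lambda2) / (RtoC (k ^ 2) - lambda1 * lambda2)
   * (Cexp (- (lambda1 * RtoC delta)) - Cexp (- (lambda2 * RtoC delta))))%C.

Definition Ecla : C := Cexp (- (RtoC delta * (lambda1 + lambda2)))%C.

Definition disc : C := Csqrt (Xcla * Xcla * (Xcla * Xcla + RtoC 4 * Ecla))%C.

Definition r_plus : C := (Xcla * Xcla / RtoC 2 + Ecla + disc / RtoC 2)%C.
Definition r_minus : C := (Xcla * Xcla / RtoC 2 + Ecla - disc / RtoC 2)%C.

(* Spectral radius, in the Fourier mode k, of the double sweep of the classical
   parallel Schwarz method with overlap delta. *)
Definition rho_cla : R := Rmax (Cmod r_plus) (Cmod r_minus).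

End ConvergenceFactor.

(* Main.v *)
Require Import Defs.
From Stdlib Require Import Reals.
From Coquelicot Require Import Coquelicot.
From Stdlib Require Import Lra Psatz.
Open Scope R_scope.

(** Write a_j = exp (- lambda_j delta), m = (k^2 + lambda_1 lambda_2) /
    (k^2 - lambda_1 lambda_2), so that X = m (a_1 - a_2), and E = a_1 a_2.  The
    double sweep eigenvalues r_+ and r_- are the squares of the two roots t of
    t^2 - X t - E = 0, so the convergence factor is below, at or above 1 exactly
    as the larger root is inside, on or outside the unit circle.  A unimodular
    factor e can be pulled out, t = e tau, which turns the equation into
    tau^2 - Y tau - b = 0 with X = e Y and E = e^2 b ([rho_cla_sqr_roots]); e is
    chosen so that b = |E| is real.  Put wp = omega / Cp < ws = omega / Cs.

    - For k <= wp both lambda_j are imaginary, lambda_1 = i p, lambda_2 = i q.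
      Then m is real with |m| <= 1, b = 1 and Y = 2 i y with y real and
      |y| <= 1: the roots i y + sqrt (1 - y^2) and i y - sqrt (1 - y^2) are
      unimodular ([rho_cla_propagating]).

    - For k = ws, lambda_1 = 0 and m = 1: the roots are 1 and - a_2
      ([rho_cla_cutoff]).

    - For k > ws everything is real, and both roots are inside the disk as soon as
      X < 1 - E, that is
      m < sinh ((q + p) delta / 2) / sinh ((q - p) delta / 2).
      The right-hand side is at least (q + p) / (q - p) because sinh is convex on
      the half-line, and this exceeds m because q < k ([rho_cla_evanescent]).

    - For wp < k < ws, lambda_1 = i p and lambda_2 = q > 0.  Now b = a_2 =: a is
      in (0, 1), and if both roots tau were in the closed disk their sum Y would
      lie in the ellipse of semi-axes 1 - a and 1 + a ([roots_in_disk_ellipse]).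
      For small delta it does not.  The growth of the larger root degenerates as
      k tends to wp or to ws, where it is of order q p^2 delta, so an expansion in
      delta with an additive error cannot be uniform in k.  The amount by
      which Y leaves the ellipse is therefore factored exactly, the vanishing
      factor being split off, and the remaining factor tends uniformly to
      (k^2 + p^2) (k^2 - q^2) = ws^2 wp^2 > 0 ([leading_term_pos],
      [ellipse_criterion_violated]).  Explicitly, delta < wp^2 / (6 ws^3) is
      enough. *)

(** * Complex exponentials and square roots *)

Lemma root_nonneg (x : R) : 0 <= x -> root x = RtoC (sqrt x).
Proof. intros H; unfold root; destruct (Rle_dec 0 x); [reflexivity | lra]. Qed.

Lemma root_nonpos (x : R) : x <= 0 -> root x = (Ci * RtoC (sqrt (- x)))%C.
Proof.
intros H; unfold root; destruct (Rle_dec 0 x) as [H0 | _]; [ | reflexivity].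
replace x with 0 by lra.
rewrite Ropp_0, sqrt_0; ring.
Qed.

Lemma Cexp_plus (z w : C) : Cexp (z + w) = (Cexp z * Cexp w)%C.
Proof.
unfold Cexp; destruct z as [a b], w as [c d]; simpl.
rewrite exp_plus, cos_plus, sin_plus.
apply injective_projections; simpl; ring.
Qed.

Lemma Cexp_RtoC (x : R) : Cexp (RtoC x) = RtoC (exp x).
Proof.
unfold Cexp; simpl; rewrite cos_0, sin_0.
apply injective_projections; simpl; ring.
Qed.

Definition cis (x : R) : C := Cexp (0, x).

Lemma cis_plus (x y : R) : cis (x + y) = (cis x * cis y)%C.
Proof.
unfold cis; rewrite <- Cexp_plus; f_equal.
apply injective_projections; simpl; ring.
Qed.

Lemma cis_opp_mult (x : R) : (cis (- x) * cis x)%C = RtoC 1.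
Proof.
rewrite <- cis_plus, Rplus_opp_l; change (cis 0) with (Cexp (RtoC 0)).
now rewrite Cexp_RtoC, exp_0.
Qed.

Lemma cis_cos_sin (x : R) : cis x = (cos x, sin x).
Proof. unfold cis, Cexp; simpl; rewrite exp_0, !Rmult_1_l; reflexivity. Qed.

Lemma Cmod_cis (x : R) : Cmod (cis x) = 1.
Proof.
rewrite cis_cos_sin; unfold Cmod; simpl.
replace (_ + _) with 1; [apply sqrt_1 | ].
generalize (sin2_cos2 x); unfold Rsqr; lra.
Qed.

Lemma Cexp_imag_mult (p d : R) : Cexp (- (Ci * RtoC p * RtoC d)) = cis (- (p * d)).
Proof. unfold cis; f_equal; apply injective_projections; simpl; ring. Qed.

Lemma Csqr_eq (x y : C) : (x * x)%C = (y * y)%C -> x = y \/ x = (- y)%C.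
Proof.
intros H.
destruct (Ceq_dec (x - y) 0) as [Hm | Hm].
- left; replace x with (x - y + y)%C by ring; rewrite Hm; ring.
- destruct (Ceq_dec (x + y) 0) as [Hp | Hp].
  + right; replace x with (x + y - y)%C by ring; rewrite Hp; ring.
  + exfalso; apply (Cmult_neq_0 _ _ Hm Hp).
    replace ((x - y) * (x + y))%C with (x * x - y * y)%C by ring.
    rewrite H; ring.
Qed.

Lemma quadratic_split (s p : C) :
  exists t1 t2 : C, (t1 + t2)%C = s /\ (t1 * t2)%C = p.
Proof.
set (d := Csqrt (s * s - 4 * p)).
assert (Hd : (d * d)%C = (s * s - 4 * p)%C) by apply Csqrt_sqr.
exists ((s + d) / 2)%C, ((s - d) / 2)%C; split.
- field; intros H; apply RtoC_inj in H; lra.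
- transitivity ((s * s - d * d) / 4)%C.
  + field; split; intros H; apply RtoC_inj in H; lra.
  + rewrite Hd; field; intros H; apply RtoC_inj in H; lra.
Qed.

(** * The convergence factor through a quadratic equation *)

(** The discriminant of r^2 - (X^2 + 2 E) r + E^2 is X^2 (X^2 + 4 E), which is
    (t1^2 - t2^2)^2 up to the factor e^4; hence the choice of square root made in
    [disc] only decides which of r_+ and r_- is the square of which root. *)
Lemma rho_cla_sqr_roots (k omega Cp Cs delta : R) (e Y b t1 t2 : C) :
  Cmod e = 1 ->
  Xcla k omega Cp Cs delta = (e * Y)%C ->
  Ecla k omega Cp Cs delta = (e * e * b)%C ->
  (t1 + t2)%C = Y -> (t1 * t2)%C = (- b)%C ->
  rho_cla k omega Cp Cs delta = Rmax (Cmod t1 ^ 2) (Cmod t2 ^ 2).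
Proof.
intros He HX HE HY Hb.
assert (H2 : RtoC 2 <> 0) by (intros H; apply RtoC_inj in H; lra).
assert (Hb' : b = (- (t1 * t2))%C) by (rewrite Hb; ring).
assert (Hm : forall t, Cmod (e * t * (e * t)) = Cmod t ^ 2).
{ intros t; rewrite !Cmod_mult, He; ring. }
assert (Hd : (Defs.disc k omega Cp Cs delta * Defs.disc k omega Cp Cs delta)%C =
  ((e * t1 * (e * t1) - e * t2 * (e * t2)) *
   (e * t1 * (e * t1) - e * t2 * (e * t2)))%C).
{ unfold Defs.disc; rewrite Csqrt_sqr, HX, HE, Hb', <- HY; ring. }
unfold rho_cla, r_plus, r_minus.
destruct (Csqr_eq _ _ Hd) as [-> | ->]; rewrite HX, HE, Hb', <- HY.
- rewrite <- (Hm t1), <- (Hm t2); f_equal; f_equal; field; exact H2.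
- rewrite <- (Hm t1), <- (Hm t2), Rmax_comm; f_equal; f_equal; field; exact H2.
Qed.

Lemma Cmod_RtoC_sqr (x : R) : Cmod (RtoC x) ^ 2 = x ^ 2.
Proof. rewrite Cmod_R, pow2_abs; reflexivity. Qed.

Lemma Ecla_split (k omega Cp Cs delta : R) :
  Ecla k omega Cp Cs delta =
  (Cexp (- (lambda1 k omega Cs * RtoC delta)) *
   Cexp (- (lambda2 k omega Cp * RtoC delta)))%C.
Proof. unfold Ecla; rewrite <- Cexp_plus; f_equal; ring. Qed.

(** * Low frequencies and the shear cut-off: modulus one *)

(** With e = exp (- i (p + q) delta / 2), the ratios a_1 / e and a_2 / e are
    conjugate, so their difference is purely imaginary. *)
Lemma rho_cla_propagating (k omega Cp Cs delta p q : R) :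
  0 <= p * q -> 0 < k ^ 2 + p * q ->
  lambda1 k omega Cs = (Ci * RtoC p)%C -> lambda2 k omega Cp = (Ci * RtoC q)%C ->
  rho_cla k omega Cp Cs delta = 1.
Proof.
intros Hpq Hk H1 H2.
set (m := (k ^ 2 - p * q) / (k ^ 2 + p * q)).
set (th := (p - q) * delta / 2).
set (y := - m * sin th).
set (e := cis (- ((p + q) * delta / 2))).
assert (Hm : m ^ 2 <= 1).
{ assert (Hm : m * (k ^ 2 + p * q) = k ^ 2 - p * q) by (unfold m; field; lra).
  assert (0 <= k ^ 2) by nra.
  assert (-1 <= m) by (unfold m; apply Rle_div_r; lra).
  assert (m <= 1) by (unfold m; apply Rle_div_l; lra).
  nra. }
assert (Hy : y ^ 2 <= 1).
{ unfold y; generalize (SIN_bound th); intros.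
  assert (sin th ^ 2 <= 1) by nra.
  assert (0 <= m ^ 2) by nra.
  replace ((- m * sin th) ^ 2) with (m ^ 2 * sin th ^ 2) by ring; nra. }
assert (Hc := sqrt_sqrt (1 - y ^ 2) ltac:(lra)).
set (c := sqrt (1 - y ^ 2)) in *; clearbody c.
assert (Ha1 : Cexp (- (Ci * RtoC p * RtoC delta)) = (e * cis (- th))%C).
{ unfold e; rewrite Cexp_imag_mult, <- cis_plus; f_equal; unfold th; field. }
assert (Ha2 : Cexp (- (Ci * RtoC q * RtoC delta)) = (e * cis th)%C).
{ unfold e; rewrite Cexp_imag_mult, <- cis_plus; f_equal; unfold th; field. }
assert (Hu := cis_opp_mult th).
rewrite (rho_cla_sqr_roots k omega Cp Cs delta e (0, 2 * y) 1
           (c, y) (- c, y)).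
- rewrite !Cmod2_alt; simpl Re; simpl Im.
  rewrite Rmax_left; nra.
- apply Cmod_cis.
- unfold Xcla; rewrite H1, H2, Ha1, Ha2.
  replace (Ci * RtoC p * (Ci * RtoC q))%C with (RtoC (- (p * q)))
    by (apply injective_projections; simpl; ring).
  rewrite <- RtoC_plus, <- RtoC_minus.
  replace (k ^ 2 + - (p * q)) with (k ^ 2 - p * q) by ring.
  replace (k ^ 2 - - (p * q)) with (k ^ 2 + p * q) by ring.
  rewrite <- RtoC_div by lra; fold m.
  replace (0, 2 * y) with (RtoC m * (cis (- th) - cis th))%C; [ring | ].
  unfold y; rewrite !cis_cos_sin, cos_neg, sin_neg.
  apply injective_projections; simpl; ring.
- rewrite Ecla_split, H1, H2, Ha1, Ha2.
  transitivity (e * e * (cis (- th) * cis th))%C; [ring | now rewrite Hu].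
- apply injective_projections; simpl; ring.
- apply injective_projections; simpl; nra.
Qed.

Lemma rho_cla_cutoff (k omega Cp Cs delta q : R) :
  0 < k -> 0 <= q -> 0 <= delta ->
  lambda1 k omega Cs = RtoC 0 -> lambda2 k omega Cp = RtoC q ->
  rho_cla k omega Cp Cs delta = 1.
Proof.
intros Hk Hq Hd H1 H2.
assert (Ha1 : Cexp (- (RtoC 0 * RtoC delta)) = RtoC 1).
{ rewrite <- RtoC_mult, <- RtoC_opp, Cexp_RtoC; f_equal.
  replace (- (0 * delta)) with 0 by ring; apply exp_0. }
assert (Ha2 : Cexp (- (RtoC q * RtoC delta)) = RtoC (exp (- (q * delta)))).
{ rewrite <- RtoC_mult, <- RtoC_opp; apply Cexp_RtoC. }
set (a := exp (- (q * delta))) in *.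
assert (Ha : 0 < a <= 1).
{ split; [apply exp_pos | ].
  rewrite <- exp_0; unfold a.
  destruct (Req_dec (q * delta) 0) as [-> | ]; [rewrite Ropp_0; lra | ].
  left; apply exp_increasing; nra. }
rewrite (rho_cla_sqr_roots k omega Cp Cs delta 1 (1 - a) a 1 (- a)).
- rewrite Cmod_opp, !Cmod_RtoC_sqr, Rmax_left; nra.
- apply Cmod_1.
- unfold Xcla; rewrite H1, H2, Ha1, Ha2; field.
  replace (RtoC (k ^ 2) - RtoC 0 * RtoC q)%C with (RtoC (k ^ 2)) by ring.
  intros H; apply RtoC_inj in H; nra.
- rewrite Ecla_split, H1, H2, Ha1, Ha2; ring.
- ring.
- ring.
Qed.

(** * High frequencies: contraction *)
Lemma sinh_nonneg (x : R) : 0 <= x -> 0 <= sinh x.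
Proof.
intros [Hx | <-]; [ | rewrite sinh_0; lra].
rewrite <- sinh_0; left; apply sinh_lt; exact Hx.
Qed.

(** This is the monotonicity of sinh v / v between (q - p) x and (q + p) x; the
    product form of cosh ((q + p) y) - cosh ((q - p) y) makes the derivative of the
    difference of the two sides visibly nonnegative. *)
Lemma sinh_ratio (p q x : R) :
  0 <= p <= q -> 0 <= x ->
  (q + p) * sinh ((q - p) * x) <= (q - p) * sinh ((q + p) * x).
Proof.
intros Hpq Hx.
set (F := fun y => (q - p) * sinh ((q + p) * y) - (q + p) * sinh ((q - p) * y)).
set (F' := fun y => (q ^ 2 - p ^ 2) * (2 * sinh (q * y) * sinh (p * y))).
assert (HF : forall y, is_derive F y (F' y)).
{ intros y; unfold F, F', sinh; auto_derive; [exact I | ].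
  replace ((q + p) * y) with (q * y + p * y) by ring.
  replace ((q - p) * y) with (q * y + - (p * y)) by ring.
  replace (- (q * y + p * y)) with (- (q * y) + - (p * y)) by ring.
  replace (- (q * y + - (p * y))) with (- (q * y) + p * y) by ring.
  rewrite !exp_plus; field. }
assert (H0 : F 0 = 0) by (unfold F; rewrite !Rmult_0_r, sinh_0; ring).
enough (0 <= F x) by (unfold F in *; lra).
destruct (MVT_gen F 0 x F') as [c [Hc Heq]].
- intros y _; apply HF.
- intros y _; apply continuity_pt_filterlim.
  apply (ex_derive_continuous F y); eexists; apply HF.
- rewrite Rmin_left, Rmax_right in Hc by assumption.
  rewrite H0 in Heq.
  assert (0 <= F' c); [ | nra].
  unfold F'.
  assert (0 <= sinh (q * c)) by (apply sinh_nonneg; nra).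
  assert (0 <= sinh (p * c)) by (apply sinh_nonneg; nra).
  apply Rmult_le_pos; [nra | ].
  apply Rmult_le_pos; [lra | assumption].
Qed.

(** Turns both a_1 - a_2 and 1 - a_1 a_2 into the same positive factor times a
    hyperbolic sine. *)
Lemma exp_half_gap (u v x : R) :
  exp (- (u * x)) - exp (- (v * x)) =
  2 * exp (- ((u + v) * (x / 2))) * sinh ((v - u) * (x / 2)).
Proof.
unfold sinh.
replace (- (u * x)) with (- ((u + v) * (x / 2)) + (v - u) * (x / 2)) by field.
replace (- (v * x)) with (- ((u + v) * (x / 2)) + - ((v - u) * (x / 2))) by field.
rewrite !exp_plus; field.
Qed.

(** The roots are real with positive sum x, so the larger one in modulus is
    (x + s) / 2, and it is below 1 exactly when the polynomial is positive at 1. *)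
Lemma rho_cla_evanescent (k omega Cp Cs delta p q : R) :
  0 < p < q -> q < k -> 0 < delta ->
  lambda1 k omega Cs = RtoC p -> lambda2 k omega Cp = RtoC q ->
  rho_cla k omega Cp Cs delta < 1.
Proof.
intros Hpq Hqk Hd H1 H2.
assert (Hpk : p * q < k ^ 2) by nra.
assert (Ha1 : Cexp (- (RtoC p * RtoC delta)) = RtoC (exp (- (p * delta))))
  by (rewrite <- RtoC_mult, <- RtoC_opp; apply Cexp_RtoC).
assert (Ha2 : Cexp (- (RtoC q * RtoC delta)) = RtoC (exp (- (q * delta))))
  by (rewrite <- RtoC_mult, <- RtoC_opp; apply Cexp_RtoC).
assert (Hratio : (q + p) * (exp (- (p * delta)) - exp (- (q * delta))) <=
  (q - p) * (1 - exp (- (p * delta)) * exp (- (q * delta)))).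
{ assert (Hs := sinh_ratio p q (delta / 2) ltac:(lra) ltac:(lra)).
  assert (Hg := exp_half_gap 0 (p + q) delta).
  replace (- (0 * delta)) with 0 in Hg by ring; rewrite exp_0 in Hg.
  rewrite <- exp_plus, exp_half_gap.
  replace (- (p * delta) + - (q * delta)) with (- ((p + q) * delta)) by ring.
  rewrite Hg, Rplus_0_l.
  replace (p + q - 0) with (q + p) by ring.
  replace (p + q) with (q + p) by ring.
  generalize (exp_pos (- ((q + p) * (delta / 2)))); nra. }
assert (Hd0 : exp (- (q * delta)) < exp (- (p * delta)))
  by (apply exp_increasing; nra).
assert (Hp1 : exp (- (p * delta)) < 1) by (rewrite <- exp_0; apply exp_increasing; nra).
assert (Hq0 := exp_pos (- (q * delta))).
set (a1 := exp (- (p * delta))) in *; set (a2 := exp (- (q * delta))) in *.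
set (x := (k ^ 2 + p * q) / (k ^ 2 - p * q) * (a1 - a2)).
assert (Hx0 : 0 < x).
{ unfold x; apply Rmult_lt_0_compat; [apply Rdiv_lt_0_compat; nra | lra]. }
assert (Hx1 : x < 1 - a1 * a2).
{ unfold x.
  replace (_ * (a1 - a2)) with ((k ^ 2 + p * q) * (a1 - a2) / (k ^ 2 - p * q))
    by (field; lra).
  apply Rlt_div_l; [lra | ].
  apply Rmult_lt_reg_l with (q - p); [lra | ].
  rewrite <- (Rmult_assoc (q - p) (1 - a1 * a2)).
  apply Rlt_le_trans with ((q + p) * (a1 - a2) * (k ^ 2 - p * q));
    [ | apply Rmult_le_compat_r; lra].
  assert (0 < 2 * p * (k ^ 2 - q ^ 2) * (a1 - a2))
    by (repeat apply Rmult_lt_0_compat; nra).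
  nra. }
assert (He : 0 < a1 * a2) by nra.
assert (Hs := sqrt_sqrt (x ^ 2 + 4 * (a1 * a2)) ltac:(nra)).
assert (Hs0 := sqrt_pos (x ^ 2 + 4 * (a1 * a2))).
set (s := sqrt (x ^ 2 + 4 * (a1 * a2))) in *.
assert (Hs2 : s < 2 - x) by nra.
rewrite (rho_cla_sqr_roots k omega Cp Cs delta 1 x (a1 * a2)%R
           ((x + s) / 2)%R ((x - s) / 2)%R).
- rewrite !Cmod_RtoC_sqr; apply Rmax_lub_lt; nra.
- apply Cmod_1.
- unfold Xcla, x; rewrite H1, H2, Ha1, Ha2.
  rewrite <- !RtoC_mult, <- !RtoC_plus, <- !RtoC_minus, <- RtoC_div by lra.
  rewrite <- !RtoC_mult; f_equal; ring.
- rewrite Ecla_split, H1, H2, Ha1, Ha2, RtoC_mult; ring.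
- rewrite <- RtoC_plus; f_equal; field.
- rewrite <- RtoC_mult, <- RtoC_opp; f_equal.
  transitivity ((x ^ 2 - s * s) / 4)%R; [field | rewrite Hs; field].
Qed.

(** * Intermediate frequencies: growth *)

(** This is one half of the Schur-Cohn criterion for tau^2 - Y tau - a.  With
    Y = t1 + t2 and t1 t2 = - a, the number Y + a conj Y equals
    t1 (1 - |t2|^2) + t2 (1 - |t1|^2), whose modulus is at most
    (|t1| + |t2|) (1 - |t1 t2|) <= (1 + |t1 t2|) (1 - |t1 t2|). *)
Lemma roots_in_disk_ellipse (a : R) (t1 t2 : C) :
  0 <= a <= 1 ->
  (t1 * t2)%C = (- RtoC a)%C ->
  Cmod t1 <= 1 -> Cmod t2 <= 1 ->
  (1 + a) ^ 2 * Re (t1 + t2) ^ 2 + (1 - a) ^ 2 * Im (t1 + t2) ^ 2 <= (1 - a ^ 2) ^ 2.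
Proof.
intros Ha Hp H1 H2.
assert (G1 := Cmod_ge_0 t1); assert (G2 := Cmod_ge_0 t2).
assert (Hprod : Cmod t1 * Cmod t2 = a).
{ rewrite <- Cmod_mult, Hp, Cmod_opp, Cmod_R; apply Rabs_pos_eq; lra. }
set (w := (t1 * RtoC (1 - Cmod t2 ^ 2) + t2 * RtoC (1 - Cmod t1 ^ 2))%C).
assert (Hw : w = ((1 + a) * Re (t1 + t2), (1 - a) * Im (t1 + t2))).
{ transitivity (t1 + t2 - t1 * t2 * Cconj (t1 + t2))%C.
  - unfold w; rewrite !RtoC_minus, !Cmod2_conj, Cplus_conj; ring.
  - rewrite Hp; apply injective_projections; simpl; ring. }
assert (Hm : Cmod w <= 1 - a ^ 2).
{ eapply Rle_trans; [apply Cmod_triangle | ].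
  rewrite !Cmod_mult, !Cmod_R, !Rabs_pos_eq by nra.
  assert (0 <= (1 - Cmod t1) * (1 - Cmod t2) * (1 - a))
    by (repeat apply Rmult_le_pos; lra).
  replace (_ + _) with ((Cmod t1 + Cmod t2) * (1 - Cmod t1 * Cmod t2)) by ring.
  replace ((1 - Cmod t1) * (1 - Cmod t2))
    with (1 + Cmod t1 * Cmod t2 - (Cmod t1 + Cmod t2)) in * by ring.
  rewrite Hprod in *; lra. }
replace (_ + _) with (Cmod w ^ 2).
- apply pow_incr; split; [apply Cmod_ge_0 | exact Hm].
- rewrite Cmod2_alt, Hw; simpl; ring.
Qed.

Lemma cos_lower (x : R) : 0 <= x <= 1 -> 1 - x <= cos x.
Proof.
intros Hx; destruct (Req_dec x 0) as [-> | Hx0]; [rewrite cos_0; lra | ].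
assert (H1 := sin_lt_x (x / 2) ltac:(lra)).
assert (H2 : 0 <= sin (x / 2)) by (generalize PI2_1; intros; apply sin_ge_0; lra).
replace (cos x) with (cos (2 * (x / 2))) by (f_equal; field).
rewrite cos_2a_sin; nra.
Qed.

Lemma sin_quotient_bounds (x : R) : 0 < x <= 1 -> 1 - x <= sin x / x <= 1.
Proof.
intros Hx; split.
- apply Rle_div_r; [lra | ].
  destruct (MVT_cor2 sin cos 0 x) as [c [Heq Hc]]; [lra | intros; apply derivable_pt_lim_sin | ].
  rewrite sin_0 in Heq.
  assert (Hcos := cos_lower c ltac:(lra)); nra.
- apply Rle_div_l; [lra | ].
  generalize (sin_lt_x x); lra.
Qed.

Lemma exp_quotient_bounds (x : R) : 0 < x -> 1 - x <= (1 - exp (- x)) / x <= 1.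
Proof.
intros Hx.
assert (H1 := exp_ineq1_le (- x)); assert (H2 := exp_ineq1_le x).
assert (H3 : exp (- x) * exp x = 1).
{ rewrite <- exp_plus; replace (- x + x) with 0 by ring; apply exp_0. }
assert (H4 := exp_pos (- x)).
split; [apply Rle_div_r | apply Rle_div_l]; nra.
Qed.

Lemma near_one_mult (u v m n : R) :
  0 <= m -> 0 <= n -> m + n <= 1 ->
  1 - m <= u <= 1 -> 1 - n <= v <= 1 -> 1 - (m + n) <= u * v <= 1.
Proof. intros; nra. Qed.

(** For A = B = D = 1 the expression is (k^2 + p^2) (k^2 - q^2) = ws^2 wp^2; the
    perturbation costs at most eta k^2 (k^2 + p^2) = eta k^2 ws^2. *)
Lemma leading_term_pos (wp ws k p q eta A B D : R) :
  0 < k < ws -> 0 < p -> 0 < q ->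
  p ^ 2 = ws ^ 2 - k ^ 2 -> q ^ 2 = k ^ 2 - wp ^ 2 ->
  0 <= eta -> eta * ws ^ 2 < wp ^ 2 ->
  1 - eta <= A <= 1 -> 1 - eta <= B -> D <= 1 ->
  0 < (k ^ 4 - p ^ 2 * q ^ 2) * A + k ^ 2 * (p ^ 2 * B - q ^ 2 * D).
Proof.
intros Hk Hp Hq Hp2 Hq2 He0 He HA HB HD.
assert (Hk2 : 0 < k ^ 2 < ws ^ 2) by nra.
assert (HP : 0 < p ^ 2) by nra; assert (HQ : 0 < q ^ 2) by nra.
replace (k ^ 4) with (k ^ 2 * k ^ 2) by ring.
set (K := k ^ 2) in *; set (P := p ^ 2) in *; set (Q := q ^ 2) in *.
assert (HPQ : 0 < P * Q) by nra.
assert (L1 : K * K - P * Q - eta * (K * K) <= (K * K - P * Q) * A).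
{ set (PQ := P * Q) in *; destruct (Rle_dec 0 (K * K - PQ)); nra. }
assert (L2 : P - eta * P <= P * B) by nra.
assert (L3 : Q * D <= Q) by nra.
assert (L4 : 0 < ws ^ 2 * (wp ^ 2 - eta * K)) by (apply Rmult_lt_0_compat; nra).
replace (ws ^ 2) with (K + P) in L4 by lra.
replace (wp ^ 2) with (K - Q) in L4 by lra.
nra.
Qed.

(** Here c + i s is the unimodular number m and al = p delta / 2, and the two
    squared brackets are the real and imaginary parts of Y = m (e - a conj e) with
    e = exp (- i al).  Writing sin al = al g and 1 - a = q delta b, with g, b, a and
    cos al all within ws delta of 1, the excess of the right-hand side over the left
    is 8 s delta^2 p q / (k^4 + p^2 q^2) times the expression of
    [leading_term_pos], plus a square. *)
Lemma ellipse_criterion_violated (wp ws k p q delta : R) :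
  0 < wp < k -> k < ws -> 0 < p -> 0 < q ->
  p ^ 2 = ws ^ 2 - k ^ 2 -> q ^ 2 = k ^ 2 - wp ^ 2 ->
  0 < delta -> 6 * ws ^ 3 * delta < wp ^ 2 ->
  let a := exp (- (q * delta)) in
  let al := p * delta / 2 in
  let c := (k ^ 4 - p ^ 2 * q ^ 2) / (k ^ 4 + p ^ 2 * q ^ 2) in
  let s := 2 * k ^ 2 * p * q / (k ^ 4 + p ^ 2 * q ^ 2) in
  (1 - a ^ 2) ^ 2 <
  (1 + a) ^ 2 * ((1 - a) * c * cos al + (1 + a) * s * sin al) ^ 2 +
  (1 - a) ^ 2 * ((1 - a) * s * cos al - (1 + a) * c * sin al) ^ 2.
Proof.
intros Hwp Hws Hp Hq Hp2 Hq2 Hd Hd6 a al c s.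
set (ep := ws * delta).
assert (Hep : 0 < ep) by (unfold ep; nra).
assert (Hep6 : 6 * ep * ws ^ 2 < wp ^ 2) by (unfold ep; nra).
assert (Hww : wp ^ 2 < ws ^ 2) by nra.
assert (Hep1 : 6 * ep < 1) by nra.
assert (Hpws : p < ws) by nra.
assert (Hqws : q < ws) by nra.
assert (Hal : 0 < al < ep) by (unfold al, ep; nra).
assert (Hqd : 0 < q * delta < ep) by (unfold ep; nra).
set (g := sin al / al).
set (b := (1 - a) / (q * delta)).
assert (Hg : 1 - ep <= g <= 1) by (generalize (sin_quotient_bounds al); unfold g; lra).
assert (Hb : 1 - ep <= b <= 1) by (generalize (exp_quotient_bounds (q * delta)); unfold b, a; lra).
assert (Hca : 1 - ep <= cos al <= 1).
{ generalize (cos_lower al) (COS_bound al); lra. }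
assert (Ha : 1 - ep <= a <= 1).
{ split; [generalize (exp_ineq1_le (- (q * delta))); unfold a; lra | ].
  unfold a; rewrite <- exp_0; left; apply exp_increasing; lra. }
assert (Hh : 1 - ep <= (1 + a) / 2 <= 1) by lra.
assert (Hsin : sin al = p * delta / 2 * g) by (unfold g, al; field; repeat split; lra).
assert (Hexp : 1 - a = q * delta * b) by (unfold b; field; repeat split; lra).
assert (HD : 0 < k ^ 4 + p ^ 2 * q ^ 2).
{ apply Rplus_lt_0_compat; repeat apply Rmult_lt_0_compat; lra. }
assert (Hcs : c ^ 2 + s ^ 2 = 1) by (unfold c, s; field; lra).
assert (Htr : cos al ^ 2 + sin al ^ 2 = 1)
  by (generalize (sin2_cos2 al); unfold Rsqr; lra).
clearbody g b.
(* A, B and Cc collect the correction factors, all close to 1, of the three terms. *)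
set (h := (1 + a) / 2) in *.
set (A := g * cos al * b * a * h).
set (B := h * h * h * h * g * g).
set (Cc := b * b * h * h).
assert (HA : 1 - 5 * ep <= A <= 1).
{ unfold A.
  replace (5 * ep) with (ep + ep + ep + ep + ep) by ring.
  repeat apply near_one_mult; lra. }
assert (HB : 1 - 6 * ep <= B <= 1).
{ unfold B.
  replace (6 * ep) with (ep + ep + ep + ep + ep + ep) by ring.
  repeat apply near_one_mult; lra. }
assert (HC : Cc <= 1).
{ enough (1 - (ep + ep + ep + ep) <= Cc <= 1) by lra.
  unfold Cc; repeat apply near_one_mult; lra. }
assert (Hmain : 0 < (k ^ 4 - p ^ 2 * q ^ 2) * A + k ^ 2 * (p ^ 2 * B - q ^ 2 * Cc)).
{ apply (leading_term_pos wp ws k p q (6 * ep)); lra. }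
set (D := k ^ 4 + p ^ 2 * q ^ 2) in *.
assert (Hs0 : 0 < s).
{ unfold s; apply Rdiv_lt_0_compat; [ | exact HD].
  repeat apply Rmult_lt_0_compat; lra. }
assert (Hc : c * D = k ^ 4 - p ^ 2 * q ^ 2) by (unfold c; field; lra).
assert (Hs : s * D = 2 * k ^ 2 * p * q) by (unfold s; field; lra).
clearbody c s D.
(* The excess over the ellipse bound, without the square (s (1 - a)^2 cos al)^2. *)
assert (Hgap : 0 < 8 * s * c * sin al * cos al * a * (1 - a ^ 2) +
  s ^ 2 * ((1 + a) ^ 4 * sin al ^ 2 - (1 - a ^ 2) ^ 2)).
{ apply Rmult_lt_reg_r with D; [exact HD | rewrite Rmult_0_l].
  replace (1 - a ^ 2) with ((1 - a) * (2 * h)) by (unfold h; field).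
  replace (1 + a) with (2 * h) by (unfold h; field).
  rewrite Hsin, Hexp.
  replace (_ * D) with (4 * s * delta ^ 2 * (p * q) * (2 * (c * D) * A) +
    4 * s * delta ^ 2 * (s * D) * (p ^ 2 * B - q ^ 2 * Cc))
    by (unfold A, B, Cc; field).
  rewrite Hc, Hs.
  assert (0 < s * delta ^ 2 * (p * q)) by (repeat apply Rmult_lt_0_compat; lra).
  replace (_ + _) with (8 * (s * delta ^ 2 * (p * q)) *
    ((k ^ 4 - p ^ 2 * q ^ 2) * A + k ^ 2 * (p ^ 2 * B - q ^ 2 * Cc))) by ring.
  apply Rmult_lt_0_compat; [lra | exact Hmain]. }
assert (0 <= s ^ 2 * (1 - a) ^ 4 * cos al ^ 2).
{ replace (s ^ 2 * (1 - a) ^ 4 * cos al ^ 2)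
    with ((s * (1 - a) ^ 2 * cos al) ^ 2) by ring; apply pow2_ge_0. }
enough (Hid : (1 + a) ^ 2 * ((1 - a) * c * cos al + (1 + a) * s * sin al) ^ 2 +
  (1 - a) ^ 2 * ((1 - a) * s * cos al - (1 + a) * c * sin al) ^ 2 =
  (1 - a ^ 2) ^ 2 +
  (8 * s * c * sin al * cos al * a * (1 - a ^ 2) +
   s ^ 2 * ((1 + a) ^ 4 * sin al ^ 2 - (1 - a ^ 2) ^ 2)) +
   s ^ 2 * (1 - a) ^ 4 * cos al ^ 2) by lra.
transitivity ((1 - a ^ 2) ^ 2 * (c ^ 2 * (cos al ^ 2 + sin al ^ 2)) +
  (8 * s * c * sin al * cos al * a * (1 - a ^ 2) +
   s ^ 2 * ((1 + a) ^ 4 * sin al ^ 2)) + s ^ 2 * (1 - a) ^ 4 * cos al ^ 2); [ring | ].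
rewrite Htr; replace (c ^ 2) with (1 - s ^ 2) by lra; ring.
Qed.

(** The phase e = exp (- i p delta / 2) is half of the phase of E = e^2 a, which
    makes the constant term of the equation for tau real. *)
Lemma rho_cla_mixed (wp ws k omega Cp Cs delta p q : R) :
  0 < wp < k -> k < ws -> 0 < p -> 0 < q ->
  p ^ 2 = ws ^ 2 - k ^ 2 -> q ^ 2 = k ^ 2 - wp ^ 2 ->
  0 < delta -> 6 * ws ^ 3 * delta < wp ^ 2 ->
  lambda1 k omega Cs = (Ci * RtoC p)%C -> lambda2 k omega Cp = RtoC q ->
  1 < rho_cla k omega Cp Cs delta.
Proof.
intros Hwp Hws Hp Hq Hp2 Hq2 Hd Hd6 H1 H2.
assert (Hcrit := ellipse_criterion_violated wp ws k p q delta Hwp Hws Hp Hq Hp2 Hq2 Hd Hd6).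
cbv zeta in Hcrit.
set (a := exp (- (q * delta))) in *.
set (al := p * delta / 2) in *.
assert (HD : 0 < k ^ 4 + p ^ 2 * q ^ 2).
{ apply Rplus_lt_0_compat; repeat apply Rmult_lt_0_compat; lra. }
set (c := (k ^ 4 - p ^ 2 * q ^ 2) / (k ^ 4 + p ^ 2 * q ^ 2)) in *.
set (s := 2 * k ^ 2 * p * q / (k ^ 4 + p ^ 2 * q ^ 2)) in *.
set (e := cis (- al)).
set (e' := cis al).
assert (Ha : 0 <= a <= 1).
{ split; [left; apply exp_pos | ].
  rewrite <- exp_0; left; apply exp_increasing; nra. }
assert (Ha1 : Cexp (- (Ci * RtoC p * RtoC delta)) = (e * e)%C).
{ unfold e; rewrite Cexp_imag_mult, <- cis_plus; f_equal; unfold al; field. }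
assert (Ha2 : Cexp (- (RtoC q * RtoC delta)) = RtoC a)
  by (rewrite <- RtoC_mult, <- RtoC_opp; apply Cexp_RtoC).
assert (Hu : (e * e')%C = RtoC 1) by apply cis_opp_mult.
assert (Hm : ((RtoC (k ^ 2) + Ci * RtoC p * RtoC q) /
              (RtoC (k ^ 2) - Ci * RtoC p * RtoC q))%C = (c, s)).
{ assert (Hnz : (RtoC (k ^ 2) - Ci * RtoC p * RtoC q)%C <> 0).
  { intros H; apply (f_equal fst) in H; simpl in H; nra. }
  transitivity ((c, s) * (RtoC (k ^ 2) - Ci * RtoC p * RtoC q) /
                (RtoC (k ^ 2) - Ci * RtoC p * RtoC q))%C; [ | field; exact Hnz].
  f_equal; apply injective_projections; simpl; unfold c, s; field; lra. }
set (Y := ((c, s) * (e - RtoC a * e'))%C).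
assert (HY : Y = ((1 - a) * c * cos al + (1 + a) * s * sin al,
                  (1 - a) * s * cos al - (1 + a) * c * sin al)).
{ unfold Y, e, e'; rewrite !cis_cos_sin, cos_neg, sin_neg.
  apply injective_projections; simpl; ring. }
destruct (quadratic_split Y (- RtoC a)) as [t1 [t2 [Hsum Hprod]]].
rewrite (rho_cla_sqr_roots k omega Cp Cs delta e Y a t1 t2).
- apply Rnot_le_lt; intros Hle.
  assert (Hin : forall t, Cmod t ^ 2 <= 1 -> Cmod t <= 1)
    by (intros t Ht; generalize (Cmod_ge_0 t); nra).
  assert (Hell := roots_in_disk_ellipse a t1 t2 Ha Hprod
    (Hin _ (Rle_trans _ _ _ (Rmax_l _ _) Hle))
    (Hin _ (Rle_trans _ _ _ (Rmax_r _ _) Hle))).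
  rewrite Hsum, HY in Hell; simpl Re in Hell; simpl Im in Hell.
  lra.
- apply Cmod_cis.
- unfold Xcla; rewrite H1, H2, Ha1, Ha2, Hm; unfold Y.
  replace (RtoC a) with (RtoC a * (e * e'))%C at 1 by (rewrite Hu; ring).
  ring.
- rewrite Ecla_split, H1, H2, Ha1, Ha2; reflexivity.
- exact Hsum.
- exact Hprod.
Qed.

(** * The four frequency regimes *)
Theorem theorem2p2 :
  forall omega Cp Cs : R, 0 < omega ->
  exists delta0 : R, 0 < delta0 /\
  forall lam mu rho : R, 0 < lam -> 0 < mu -> 0 < rho ->
  Cp = sqrt ((lam + 2 * mu) / rho) -> Cs = sqrt (mu / rho) ->
  (forall delta k : R, 0 < delta ->
     (0 <= k <= omega / Cp \/ k = omega / Cs) ->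
     Rabs (rho_cla k omega Cp Cs delta) = 1) /\
  (forall delta : R, 0 < delta < delta0 ->
     (forall k : R, omega / Cp < k < omega / Cs ->
        Rabs (rho_cla k omega Cp Cs delta) > 1) /\
     (forall k : R, omega / Cs < k ->
        Rabs (rho_cla k omega Cp Cs delta) < 1)).
Proof.
intros omega Cp Cs Hom.
(* The threshold is chosen before the Lame parameters, which imply 0 < Cs < Cp;
   for other speeds any threshold works vacuously. *)
destruct (Rlt_dec 0 Cs) as [HCs | HCs]; cycle 1.
{ exists 1; split; [lra | ].
  intros lam mu rho Hl Hm Hr _ E; exfalso; apply HCs; rewrite E.
  apply sqrt_lt_R0, Rdiv_lt_0_compat; assumption. }
destruct (Rlt_dec Cs Cp) as [HCp | HCp]; cycle 1.
{ exists 1; split; [lra | ].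
  intros lam mu rho Hl Hm Hr E1 E2; exfalso; apply HCp; rewrite E1, E2.
  apply sqrt_lt_1_alt; split.
  - left; apply Rdiv_lt_0_compat; assumption.
  - apply Rmult_lt_compat_r; [apply Rinv_0_lt_compat; assumption | lra]. }
set (wp := omega / Cp); set (ws := omega / Cs).
assert (Hwp : 0 < wp) by (apply Rdiv_lt_0_compat; lra).
assert (Hws : wp < ws).
{ apply Rmult_lt_compat_l; [assumption | ].
  apply Rinv_lt_contravar; [nra | assumption]. }
assert (Hws3 : 0 < 6 * ws ^ 3) by (apply Rmult_lt_0_compat; [ | apply pow_lt]; lra).
exists (wp ^ 2 / (6 * ws ^ 3)); split; [apply Rdiv_lt_0_compat; nra | ].
intros _ _ _ _ _ _ _ _.
assert (Hl1 : forall k, lambda1 k omega Cs = root (k ^ 2 - ws ^ 2))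
  by (intros k; unfold lambda1, ws; do 2 f_equal; field; lra).
assert (Hl2 : forall k, lambda2 k omega Cp = root (k ^ 2 - wp ^ 2))
  by (intros k; unfold lambda2, wp; do 2 f_equal; field; lra).
assert (Habs : forall k delta,
  Rabs (rho_cla k omega Cp Cs delta) = rho_cla k omega Cp Cs delta).
{ intros k delta; apply Rabs_pos_eq.
  eapply Rle_trans; [apply Cmod_ge_0 | apply Rmax_l]. }
split; [intros delta k Hd [Hk | Hk] | intros delta Hd; split; intros k Hk]; rewrite Habs.
- apply (rho_cla_propagating _ _ _ _ _
    (sqrt (- (k ^ 2 - ws ^ 2))) (sqrt (- (k ^ 2 - wp ^ 2)))).
  + apply Rmult_le_pos; apply sqrt_pos.
  + destruct (Req_dec k 0) as [-> | Hk0].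
    * assert (0 < sqrt (- (0 ^ 2 - ws ^ 2))) by (apply sqrt_lt_R0; nra).
      assert (0 < sqrt (- (0 ^ 2 - wp ^ 2))) by (apply sqrt_lt_R0; nra).
      nra.
    * assert (0 <= sqrt (- (k ^ 2 - ws ^ 2)) * sqrt (- (k ^ 2 - wp ^ 2)))
        by (apply Rmult_le_pos; apply sqrt_pos).
      nra.
  + rewrite Hl1; apply root_nonpos; nra.
  + rewrite Hl2; apply root_nonpos; nra.
- fold ws in Hk; apply (rho_cla_cutoff _ _ _ _ _ (sqrt (k ^ 2 - wp ^ 2))).
  + lra.
  + apply sqrt_pos.
  + lra.
  + rewrite Hl1, Hk, root_nonneg by lra.
    replace (ws ^ 2 - ws ^ 2) with 0 by ring; now rewrite sqrt_0.
  + rewrite Hl2; apply root_nonneg; nra.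
- fold wp ws in Hk.
  apply (rho_cla_mixed wp ws _ _ _ _ _
    (sqrt (- (k ^ 2 - ws ^ 2))) (sqrt (k ^ 2 - wp ^ 2))); try lra.
  + apply sqrt_lt_R0; nra.
  + apply sqrt_lt_R0; nra.
  + rewrite pow2_sqrt; nra.
  + rewrite pow2_sqrt; nra.
  + destruct Hd as [_ Hd]; apply Rlt_div_r in Hd; lra.
  + rewrite Hl1; apply root_nonpos; nra.
  + rewrite Hl2; apply root_nonneg; nra.
- fold ws in Hk.
  assert (Hq := pow2_sqrt (k ^ 2 - wp ^ 2) ltac:(nra)).
  assert (Hq0 := sqrt_pos (k ^ 2 - wp ^ 2)).
  apply (rho_cla_evanescent _ _ _ _ _ (sqrt (k ^ 2 - ws ^ 2)) (sqrt (k ^ 2 - wp ^ 2))).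
  + split; [apply sqrt_lt_R0 | apply sqrt_lt_1_alt]; nra.
  + nra.
  + lra.
  + rewrite Hl1; apply root_nonneg; nra.
  + rewrite Hl2; apply root_nonneg; nra.
Qed.
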